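(* For all $n, k \in \mathbb{Z}_+=\{0,1,2,\dots\}$ with $n > k$, $$\sum_{j=0}^{n-k}\binom{n-k}{j}(-1)^j E_{k+j} = \begin{cases} 2+E_n & \text{if } k=0,\\[2mm] \displaystyle\sum_{j=0}^{k}\binom{k}{j}(-1)^{k-j}E_{n-j} & \text{if } k>0.\end{cases}$$
   Context: The Euler numbers $E_n\in\mathbb{Q}$ ($n\ge 0$) are defined by $\frac{2}{e^t+1} = \sum_{n=0}^{\infty} E_n \frac{t^n}{n!}$. *)

(* Defs.v *)
From mathcomp Require Import all_boot all_order all_algebra.

Set Implicit Arguments.
Unset Strict Implicit.
Unset Printing Implicit Defensive.

Import GRing.Theory.

Local Open Scope ring_scope.

(* A formal power series over F is the sequence of its coefficients; two       *)
(* series are identified when they agree pointwise (=1).                       *)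
Definition fps (F : fieldType) := nat -> F.

Definition fps_const (F : fieldType) (c : F) : fps F :=
  fun n => if n == 0%N then c else 0.

Definition fps_add (F : fieldType) (f g : fps F) : fps F :=
  fun n => f n + g n.

Definition fps_mul (F : fieldType) (f g : fps F) : fps F :=
  fun n => \sum_(i < n.+1) f i * g (n - i)%N.

(* The first n coefficients of f / g, obtained by solving g * h = f degree by  *)
(* degree. Only meaningful when g is invertible, i.e., when g 0 != 0; this is  *)
(* justified by fps_divP below.                                                *)
Fixpoint fps_div_prefix (F : fieldType) (f g : fps F) (n : nat) : seq F :=
  if n is m.+1 then
    let s := fps_div_prefix f g m in
    rcons s ((f m - \sum_(i < m) g (m - i)%N * s`_i) / g 0%N)
  else [::].

Definition fps_div (F : fieldType) (f g : fps F) : fps F :=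
  fun n => (fps_div_prefix f g n.+1)`_n.

Lemma size_fps_div_prefix (F : fieldType) (f g : fps F) n :
  size (fps_div_prefix f g n) = n.
Proof. by elim: n => //= n IHn; rewrite size_rcons IHn. Qed.

Lemma nth_fps_div_prefix (F : fieldType) (f g : fps F) n i :
  (i < n)%N -> (fps_div_prefix f g n)`_i = fps_div f g i.
Proof.
elim: n => // n IHn; rewrite ltnS leq_eqVlt => /predU1P[-> //|lt_in].
by rewrite /= nth_rcons size_fps_div_prefix lt_in IHn.
Qed.

Lemma fps_divE (F : fieldType) (f g : fps F) n :
  fps_div f g n = (f n - \sum_(i < n) g (n - i)%N * fps_div f g i) / g 0%N.
Proof.
rewrite {1}/fps_div /= nth_rcons size_fps_div_prefix ltnn eqxx.
by under eq_bigr => i _ do rewrite nth_fps_div_prefix //.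
Qed.

Lemma fps_mulE (F : fieldType) (g h : fps F) n :
  fps_mul g h n = g 0%N * h n + \sum_(i < n) g (n - i)%N * h i.
Proof.
rewrite /fps_mul (reindex_inj rev_ord_inj) /= big_ord_recr /= subnn subn0 addrC.
congr (_ + _); apply: eq_bigr => i _.
by rewrite subSS subKn // ltnW.
Qed.

Lemma fps_divP (F : fieldType) (f g h : fps F) : g 0%N != 0 ->
  fps_mul g h =1 f <-> h =1 fps_div f g.
Proof.
move=> g0; split=> [ghf n | hE n]; last first.
  rewrite fps_mulE hE fps_divE mulrC divfK // -addrA; apply/eqP.
  rewrite -subr_eq0 addrAC subrr add0r addrC subr_eq0.
  by apply/eqP/eq_bigr => i _; rewrite hE.
elim/ltn_ind: n => n IHn; rewrite fps_divE -ghf fps_mulE.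
under [X in _ - X]eq_bigr => i _ do rewrite -IHn //.
by rewrite addrK mulrC mulKf.
Qed.

Definition fps_exp : fps rat := fun n => (n`!%:R)^-1.

(* E_n = n! [t^n] 2 / (e^t + 1) *)
Definition euler (n : nat) : rat :=
  n`!%:R * fps_div (fps_const 2) (fps_add fps_exp (fps_const 1)) n.

Lemma euler_egf :
  fps_mul (fps_add fps_exp (fps_const 1)) (fun n => euler n / n`!%:R)
    =1 fps_const 2.
Proof.
apply/fps_divP => // n; rewrite /euler mulrC mulKf //.
by rewrite Num.Theory.pnatr_eq0 -lt0n fact_gt0.
Qed.

(* Main.v *)
(** Umbral calculus: let [L] be the linear functional on polynomials sending
    [x^n] to [E_n]. The generating function says [L p(x+1) + L p(x) = 2 p(0)], an
    equation that determines [L]. As [p |-> 2 p(0) - L p(-x)] satisfies it too,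
    [L p(-x) + L p(x) = 2 p(0)]. Combining both equations gives
    [L p(x) - L p(1-x) = 2 p(0) - 2 p(1)], and the theorem is the case
    [p = x^k (1-x)^(n-k)]. *)

Require Import Defs.
From HB Require Import structures.
From mathcomp Require Import all_boot all_order all_algebra.
From mathcomp Require Import ring lra.

Local Open Scope ring_scope.
Import GRing.Theory Num.Theory.

(** Compare the coefficients of t^n in [euler_egf], multiplied by n!: the factor e^t yields the
    binomial sum, the factor 1 the extra [euler n]. *)
Lemma euler_rec (n : nat) :
  \sum_(i < n.+1) 'C(n, i)%:R * euler i + euler n = 2 *+ (n == 0%N).
Proof.
have fact_neq0 m : m`!%:R != 0 :> rat by rewrite pnatr_eq0 -lt0n fact_gt0.
have := congr1 ( *%R n`!%:R) (euler_egf n).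
rewrite fps_mulE /fps_add /fps_exp /fps_const eqxx fact0 invr1.
rewrite mulrDr mulr_sumr.
under eq_bigr => i _.
  rewrite subn_eq0 leqNgt ltn_ord addr0 /= mulrA -(bin_fact (ltnW (ltn_ord i))).
  rewrite !natrM.
  have -> : 'C(n, i)%:R * (i`!%:R * (n - i)`!%:R) / (n - i)`!%:R * (euler i / i`!%:R)
    = 'C(n, i)%:R * euler i :> rat.
    by field; rewrite !fact_neq0.
  over.
rewrite big_ord_recr /= binn mul1r -addrA addrC => H.
rewrite [RHS](_ : _ = n`!%:R * (if n == 0%N then 2 else 0)); last first.
  by case: n {H} => [|n] /=; rewrite ?fact0 ?mul1r ?mulr0.
by rewrite -H; field; rewrite fact_neq0.
Qed.

Lemma poly_monomial_ind (R : nzRingType) (P : {poly R} -> Prop) :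
    (forall n, P 'X^n) ->
    (forall a p q, P p -> P q -> P (a *: p + q)) ->
  forall p, P p.
Proof.
move=> PX Plin p; rewrite -[p]coefK poly_def.
elim/big_rec: _ => [|i q _ Pq]; last exact: Plin.
(* The empty sum 0 is the combination [-1 *: 'X^0 + 'X^0] of monomials. *)
by rewrite -(addNr 'X^0) -scaleN1r; apply: Plin; apply: PX.
Qed.

Definition euler_umbral (p : {poly rat}) : rat :=
  \sum_(i < size p) p`_i * euler i.

Lemma euler_umbral_widen (m : nat) (p : {poly rat}) : (size p <= m)%N ->
  euler_umbral p = \sum_(i < m) p`_i * euler i.
Proof.
move=> le_pm; rewrite /euler_umbral (big_ord_widen _ (fun i => p`_i * euler i) le_pm).
rewrite big_mkcond; apply: eq_bigr => i _.
by case: ltnP => // /(nth_default 0) ->; rewrite mul0r.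
Qed.

Lemma euler_umbral_linear : linear_for *%R euler_umbral.
Proof.
move=> a p q; pose m := maxn (size (a *: p + q)) (maxn (size p) (size q)).
rewrite !(@euler_umbral_widen m) ?leq_max ?leqnn ?orbT //.
rewrite mulr_sumr -big_split; apply: eq_bigr => i _ /=.
by rewrite coefD coefZ mulrDl mulrA.
Qed.

HB.instance Definition _ :=
  GRing.isLinear.Build rat {poly rat} rat *%R euler_umbral euler_umbral_linear.

Lemma euler_umbralXn (n : nat) : euler_umbral 'X^n = euler n.
Proof.
rewrite /euler_umbral size_polyXn big_ord_recr /= coefXn eqxx mul1r big1 ?add0r //.
by move=> i _; rewrite coefXn ltn_eqF ?mul0r.
Qed.

(** Both sides are linear in [p], and on ['X^n] the binomial expansion of (x+1)^n reduces the claim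
    to [euler_rec]. *)
Lemma euler_umbral_shift (p : {poly rat}) :
  euler_umbral (p \Po ('X + 1)) + euler_umbral p = 2 * p.[0].
Proof.
elim/poly_monomial_ind: p => [n|a p q IHp IHq].
  rewrite comp_Xn_poly ['X + 1]addrC exprDn raddf_sum /= euler_umbralXn hornerXn expr0n.
  rewrite mulr_natr -euler_rec; congr (_ + _).
  apply: eq_bigr => i _.
  by rewrite expr1n mul1r raddfMn /= euler_umbralXn mulr_natl.
rewrite comp_polyD comp_polyZ !linearP hornerD hornerZ /=.
by rewrite addrACA -mulrDr IHp IHq; ring.
Qed.

(** Uniqueness for the shift equation, applied to the difference of two solutions. Since (x+1)^n is
    x^n plus lower powers, on which [f] vanishes by induction, the hypothesis at ['X^n] becomes 2
    f(x^n) = 0. *)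
Lemma shift_alternating_eq0 (f : {linear {poly rat} -> rat | *%R}) :
  (forall p, f (p \Po ('X + 1)) + f p = 0) -> forall p, f p = 0.
Proof.
move=> f_shift; apply: poly_monomial_ind => [n|a p q fp fq]; last first.
  by rewrite linearP fp fq /= mulr0 addr0.
elim/ltn_ind: n => n IHn; move: (f_shift 'X^n).
rewrite comp_Xn_poly exprDn raddf_sum /= big_ord_recl /=.
rewrite subn0 expr1n mulr1 bin0 big1 => [|i _]; first by lra.
rewrite expr1n mulr1 raddfMn /= IHn ?mul0rn //.
by rewrite ltn_subrL (leq_trans _ (ltn_ord i)).
Qed.

(** Shift equation for p(1-x): replacing x by x+1 gives p(-x), and the value at 0 is p(1). *)
Lemma euler_umbral_opp_shift (p : {poly rat}) :
  euler_umbral (p \Po - 'X) + euler_umbral (p \Po (1 - 'X)) = 2 * p.[1].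
Proof.
have := euler_umbral_shift (p \Po (1 - 'X)).
rewrite -comp_polyA rmorphB /= comp_polyX rmorph1.
rewrite (_ : 1 - ('X + 1) = - 'X); last by ring.
by rewrite horner_comp !hornerE.
Qed.

Lemma euler_umbral_opp (p : {poly rat}) :
  euler_umbral (p \Po - 'X) + euler_umbral p = 2 * p.[0].
Proof.
pose f (q : {poly rat}) := euler_umbral (q \Po - 'X) + euler_umbral q - 2 * q.[0].
have f_lin : linear_for *%R f.
  move=> a q r; rewrite /f comp_polyD comp_polyZ !linearP hornerD hornerZ /=.
  by ring.
pose F := HB.pack_for {linear {poly rat} -> rat | *%R} f
  (GRing.isLinear.Build rat {poly rat} rat *%R f f_lin).
(* In f(q(x+1)) + f(q), the terms L q(1-x) + L q(-x) cancel 2 q(1), and L q(x+1) + L q(x) cancels 2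
   q(0). *)
apply/subr0_eq/(@shift_alternating_eq0 F) => q; rewrite /= /f.
have := euler_umbral_shift q; have := euler_umbral_opp_shift q.
rewrite -comp_polyA rmorphD /= comp_polyX rmorph1 [- 'X + 1]addrC.
have -> : (q \Po ('X + 1)).[0] = q.[1] by rewrite horner_comp !hornerE.
lra.
Qed.

Lemma euler_umbral_reflect (p : {poly rat}) :
  euler_umbral p = euler_umbral (p \Po (1 - 'X)) + 2 * p.[0] - 2 * p.[1].
Proof.
have := euler_umbral_opp p; have := euler_umbral_opp_shift p.
lra.
Qed.

Lemma euler_umbral_XnBn (k m : nat) :
  euler_umbral ('X^k * (1 - 'X) ^+ m) =
    \sum_(j < m.+1) 'C(m, j)%:R * (-1) ^+ j * euler (k + j).
Proof.
rewrite exprBn mulr_sumr raddf_sum; apply: eq_bigr => j _ /=.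
rewrite expr1n mulr1 mulrnAr raddfMn /= mulrCA -exprD.
rewrite -[(-1) ^+ j](rmorph_sign polyC) mul_polyC linearZ /= euler_umbralXn.
by rewrite -mulrA mulr_natl.
Qed.

Theorem corollary4 (n k : nat) (hkn : (k < n)%N) :
  \sum_(j < (n - k).+1) 'C(n - k, j)%:R * (-1) ^+ j * euler (k + j) =
  if k == 0%N then 2 + euler n
  else \sum_(j < k.+1) 'C(k, j)%:R * (-1) ^+ (k - j) * euler (n - j).
Proof.
rewrite -euler_umbral_XnBn euler_umbral_reflect.
(* The reflection swaps the roots 0 and 1, giving x^(n-k) (1-x)^k, which expands into a sum of k+1
   terms. *)
rewrite rmorphM !rmorphXn rmorphB /= comp_polyX rmorph1 mulrC.
rewrite (_ : 1 - (1 - 'X) = 'X); last by ring.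
rewrite euler_umbral_XnBn.
have -> : ('X^k * (1 - 'X) ^+ (n - k)).[0] = (k == 0%N)%:R :> rat.
  by rewrite !hornerE ?expr1n ?mulr1 expr0n.
(* Here k < n enters: 1 is a root. *)
have -> : ('X^k * (1 - 'X) ^+ (n - k)).[1] = 0 :> rat.
  by rewrite !hornerE ?subrr expr0n subn_eq0 leqNgt hkn mulr0.
rewrite mulr0 subr0; case: posnP => [->|k_gt0].
  by rewrite big_ord1 subn0 addn0 bin0 !mul1r mulr1 addrC.
(* Reversing j to k-j turns the index n-k+j into n-j. *)
rewrite mulr0 addr0 (reindex_inj rev_ord_inj); apply: eq_bigr => j _ /=.
have le_jk : (j <= k)%N by rewrite -ltnS.
by rewrite subSS bin_sub // addnBA // subnK // ltnW.
Qed.
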